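(* Let $R$ be a basic formal matrix ring of order $n$ with a Nakayama permutation $\pi$ and essential socles. Let $I\subseteq\{1,2,\dots,n\}$ be a nonempty set of indices such that $i\in I$ implies $\pi(i)\in I$, and set $e:=\sum_{i\in I}e_i$. Then $eRe$ is a ring with a Nakayama permutation $\pi|_I$ and essential socles. Furthermore, if $R$ is PF then $eRe$ is PF, and if $R$ is QF then $eRe$ is QF.
   Context: Rings are associative and unital; $J(R)$ is the Jacobson radical. Formal matrix ring of order $n$: given local rings $R_1,\dots,R_n$, $R_i$-$R_j$-bimodules $B_{i,j}$ with $B_{i,i}=R_i$, and $R_i$-$R_k$-bimodule homomorphisms $\varphi_{i,j,k}\colon B_{i,j}\otimes_{R_j}B_{j,k}\to B_{i,k}$, written $ab:=\varphi_{i,j,k}(a\otimes b)$, where $\varphi_{i,i,j}$ and $\varphi_{i,j,j}$ are the bimodule actions and $(ab)c=a(bc)$ for all $a\in B_{i,j}$, $b\in B_{j,k}$, $c\in B_{k,l}$. The ring $R$ is the set of $n\times n$ matrices whose $(i,j)$ entry lies in $B_{i,j}$, with the usual matrix addition and multiplication. The canonical idempotent $e_i$ is the matrix with $1_{R_i}$ at position $(i,i)$ and zeros elsewhere. $R$ is basic if the right modules $e_1R,\dots,e_nR$ are pairwise non-isomorphic. Nakayama permutation: a basic formal matrix ring $R$ of order $n$ is a ring with a Nakayama permutation $\pi\in S_n$ if for each $i\le n$ one has $soc(e_iR)\cong top(e_{\pi(i)}R)$ as right $R$-modules and $soc(Re_{\pi(i)})\cong top(Re_i)$ as left $R$-modules,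 where $top(M)=M/MJ(R)$ (resp. $M/J(R)M$). For $eRe$ the same definition is used with respect to the idempotents $e_i$, $i\in I$, and the permutation $\pi|_I$ of $I$. A ring has essential socles if its right socle is essential as a right ideal and its left socle is essential as a left ideal. A ring is PF (pseudo-Frobenius, also called a cogenerator ring) if it is an injective cogenerator as a right module and as a left module over itself. A ring is QF (quasi-Frobenius) if it is (left and right) artinian with a Nakayama permutation; equivalently, it is artinian and self-injective. *)

(* Defs.v *)
From HB Require Import structures.
From mathcomp Require Import all_boot all_order perm all_algebra.
From mathcomp Require Import generic_quotient ring_quotient.
From mathcomp Require Import boolp classical_sets.

Set Implicit Arguments.
Unset Strict Implicit.
Unset Printing Implicit Defensive.

Import GRing.Theory.
Local Open Scope ring_scope.

(* Rings are [pzRingType]s (unital, associative, possibly zero). A left R-module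
   is an [lmodType R] and a right R-module is an [lmodType R^c], where R^c is the
   opposite ring of R. Thus R^o is R as a left module over itself and (R^c)^o is
   R as a right module over itself. Submodules are [submodClosed] predicates; as
   excluded middle is available, boolean predicates are arbitrary subsets. *)

Section Modules.
Variables (R : pzRingType) (M : lmodType R).
Implicit Types N L : submodClosed M.

Definition nonzero_sub N := exists2 x, x \in N & x != 0.

Definition simple_sub N :=
  nonzero_sub N /\
  forall L, {subset L <= N} -> nonzero_sub L -> {subset N <= L}.

Definition maximal_sub N :=
  (exists x, x \notin N) /\
  forall L, {subset N <= L} -> (exists x, x \notin L) -> {subset L <= N}.

Definition essential_sub N :=
  forall L, nonzero_sub L -> exists2 x, (x \in L) && (x \in N) & x != 0.

Definition artinian_module :=
  forall N : nat -> submodClosed M,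
    (forall k, {subset N k.+1 <= N k}) ->
    exists k, forall m, (k <= m)%N -> {subset N k <= N m}.

(* The sum of all simple submodules. *)
Definition socle : {pred M} := fun x =>
  `[< exists2 s : seq M,
        (forall y, y \in s -> exists2 N, simple_sub N & y \in N) &
        x = \sum_(y <- s) y >].

Lemma socle_submod_closed : submod_closed socle.
Proof.
split=> [|a x y /asboolP[s hs ->] /asboolP[t ht ->]]; apply/asboolP.
  by exists [::]; rewrite ?big_nil.
exists ([seq a *: z | z <- s] ++ t).
  move=> z; rewrite mem_cat => /orP[/mapP[w /hs[N Ns wN] ->]|/ht//].
  by exists N; rewrite ?rpredZ.
by rewrite big_cat big_map scaler_sumr.
Qed.

HB.instance Definition _ :=
  GRing.isSubmodClosed.Build R M socle socle_submod_closed.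

Definition injective_module :=
  forall (A B : lmodType R) (i : {linear A -> B}) (f : {linear A -> M}),
    injective i -> exists g : {linear B -> M}, forall a, g (i a) = f a.

Definition cogenerator :=
  forall (A : lmodType R) (x : A), x != 0 ->
    exists f : {linear A -> M}, f x != 0.

End Modules.

Definition mod_iso (R : pzRingType) (M N : lmodType R) :=
  exists f : {linear M -> N}, bijective f.

Section Submodule.
Variables (R : pzRingType) (M : lmodType R) (N : submodClosed M).

Lemma submod_oppr_closed : oppr_closed N.
Proof. by move=> x xN; rewrite -scaleN1r rpredZ. Qed.

Definition submod_zmodClosed : zmodClosed M :=
  HB.pack_for (zmodClosed M) (GRing.SubmodClosed.sort N)
    (GRing.isOppClosed.Build M N submod_oppr_closed).

Record submodule := Submodule { submod_val : M; _ : submod_val \in N }.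

HB.instance Definition _ := [isSub for submod_val].
HB.instance Definition _ := [Choice of submodule by <:].
HB.instance Definition _ := [SubChoice_isSubLmodule of submodule by <:].

(* M / N, with the scalar action induced on cosets. *)
Definition quotient_module := Quotient.quot submod_zmodClosed.
HB.instance Definition _ := GRing.Zmodule.on quotient_module.

Definition quot_proj (x : M) : quotient_module :=
  (\pi_(Quotient.quot submod_zmodClosed) x)%qT.

Definition quot_scale (a : R) (u : quotient_module) : quotient_module :=
  quot_proj (a *: repr (u : Quotient.quot submod_zmodClosed)).

Lemma quot_projP x y : quot_proj x = quot_proj y <-> x - y \in N.
Proof.
split=> [xy|xy]; last by apply/eqP; rewrite -(Quotient.idealrBE submod_zmodClosed).
by move/eqP: xy; rewrite -(Quotient.idealrBE submod_zmodClosed).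
Qed.

Lemma quot_proj_repr (u : quotient_module) :
  quot_proj (repr (u : Quotient.quot submod_zmodClosed)) = u.
Proof. exact: reprK. Qed.

Lemma quot_projD : {morph quot_proj : x y / x + y}.
Proof. by move=> x y; exact: Quotient.pi_add. Qed.

Lemma quot_scaleE a x : quot_scale a (quot_proj x) = quot_proj (a *: x).
Proof. by apply/quot_projP; rewrite -scalerBr rpredZ //; apply/quot_projP/reprK. Qed.

Lemma quot_scaleA a b u : quot_scale a (quot_scale b u) = quot_scale (a * b) u.
Proof. by rewrite quot_scaleE scalerA. Qed.

Lemma quot_scale1 : left_id 1 quot_scale.
Proof. by move=> u; rewrite /quot_scale scale1r quot_proj_repr. Qed.

Lemma quot_scaleDr : right_distributive quot_scale +%R.
Proof.
move=> a u v; rewrite -[u]quot_proj_repr -[v]quot_proj_repr -quot_projD.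
by rewrite !quot_scaleE scalerDr quot_projD.
Qed.

Lemma quot_scaleDl u : {morph quot_scale^~ u : a b / a + b}.
Proof. by move=> a b; rewrite /quot_scale scalerDl quot_projD. Qed.

HB.instance Definition _ := GRing.Zmodule_isLmodule.Build R quotient_module
  quot_scaleA quot_scale1 quot_scaleDr quot_scaleDl.

End Submodule.

Section Jacobson.
Variable R : pzRingType.

(* The intersection of all maximal left ideals; by [jacobson_converse] it is
   also the intersection of all maximal right ideals. *)
Definition jacobson : {pred R^o} := fun x =>
  `[< forall N : submodClosed R^o, maximal_sub N -> x \in N >].

Lemma jacobson_submod_closed : submod_closed jacobson.
Proof.
split=> [|a x y /asboolP hx /asboolP hy]; apply/asboolP => N maxN.
  exact: rpred0.
by rewrite rpredD ?rpredZ ?hx ?hy.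
Qed.

HB.instance Definition _ :=
  GRing.isSubmodClosed.Build R R^o jacobson jacobson_submod_closed.

(* The left ideal R a. *)
Definition principal (a : R) : {pred R^o} := fun x =>
  `[< exists r : R, x = r * a >].

Lemma principal_submod_closed a : submod_closed (principal a).
Proof.
split=> [|b x y /asboolP[r ->] /asboolP[s ->]]; apply/asboolP.
  by exists 0; rewrite mul0r.
by exists (b * r + s); rewrite mulrDl -mulrA.
Qed.

HB.instance Definition _ a :=
  GRing.isSubmodClosed.Build R R^o (principal a) (principal_submod_closed a).

(* J M, the finite sums of elements j m with j in the left ideal J. *)
Definition ideal_mul (J : submodClosed R^o) (M : lmodType R) : {pred M} :=
  fun x => `[< exists2 s : seq (R * M), (forall p, p \in s -> p.1 \in J) &
                 x = \sum_(p <- s) p.1 *: p.2 >].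

Lemma ideal_mul_submod_closed J M : submod_closed (@ideal_mul J M).
Proof.
split=> [|a x y /asboolP[s hs ->] /asboolP[t ht ->]]; apply/asboolP.
  by exists [::]; rewrite ?big_nil.
exists ([seq (a * p.1, p.2) | p <- s] ++ t).
  move=> p; rewrite mem_cat => /orP[/mapP[q /hs qJ ->]|/ht//].
  exact: (@rpredZ R R^o J a _ qJ).
rewrite big_cat big_map scaler_sumr; congr (_ + _).
by apply: eq_bigr => p _; rewrite scalerA.
Qed.

HB.instance Definition _ J M :=
  GRing.isSubmodClosed.Build R M (@ideal_mul J M) (@ideal_mul_submod_closed J M).

Definition top_module (M : lmodType R) : lmodType R :=
  quotient_module (@ideal_mul jacobson M).

Definition soc_module (M : lmodType R) : lmodType R := submodule (@socle R M).

(* R a, as a left module. *)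
Definition left_ideal (a : R) : lmodType R := submodule (principal a).

End Jacobson.

Arguments jacobson : clear implicits.

Section JacobsonConverse.

Lemma exists_maximal (R : pzRingType) (N : submodClosed R^o) :
  1 \notin N -> exists2 L : submodClosed R^o, maximal_sub L & {subset N <= L}.
Proof.
move=> N1.
pose P (A : set R^o) := A = set0 \/
  exists L : submodClosed R^o,
    [/\ A = (fun x => x \in L), 1 \notin L & {subset N <= L}].
have [|A [PA maxA]] := @Zorn_bigcup R^o P.
  move=> F FP totF.
  have [[B FB [x0 Bx0]]|noB] := pselect (exists2 B, F B & exists x, B x); last first.
    left; rewrite predeqE => x; split=> // -[B FB Bx].
    by case: noB; exists B => //; exists x.
  have memF C y : F C -> C y -> exists L : submodClosed R^o,
      [/\ C = (fun x => x \in L), 1 \notin L & {subset N <= L}].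
    by move=> FC Cy; case: (FP _ FC) => // C0; rewrite C0 in Cy.
  pose U : {pred R^o} := fun x => `[< exists2 C, F C & C x >].
  have Uc : submod_closed U.
    split=> [|a x y /asboolP[C FC Cx] /asboolP[D FD Dy]]; apply/asboolP.
      exists B => //; have [L [-> _ _]] := memF _ _ FB Bx0; exact: rpred0.
    have [CD|DC] := totF _ _ FC FD.
      exists D => //; have := CD _ Cx.
      have [L [DE _ _]] := memF _ _ FD Dy; move: Dy; rewrite DE => Ly Lx.
      by rewrite rpredD ?rpredZ.
    exists C => //; have := DC _ Dy.
    have [L [CE _ _]] := memF _ _ FC Cx; move: Cx; rewrite CE => Lx Ly.
    by rewrite rpredD ?rpredZ.
  pose UL : submodClosed R^o := HB.pack U (GRing.isSubmodClosed.Build R R^o U Uc).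
  right; exists UL; split.
  - rewrite predeqE => x; split=> [[C FC Cx]|/asboolP[C FC Cx]]; last by exists C.
    by apply/asboolP; exists C.
  - apply/negP => /asboolP[C FC C1]; have [L [CE /negP + _]] := memF _ _ FC C1.
    by rewrite CE in C1.
  - move=> x Nx; apply/asboolP; exists B => //.
    by have [L [-> _ NL]] := memF _ _ FB Bx0; exact: NL.
have key (L' : submodClosed R^o) : 1 \notin L' -> {subset N <= L'} ->
    (forall x, A x -> x \in L') -> forall x, x \in L' -> A x.
  move=> L1 NL AL x xL; apply: contrapT => nAx.
  apply: (maxA (fun x => x \in L')); last by right; exists L'.
  by split=> [y /AL//|/(_ x xL)].
case: PA => [A0|[L [AE L1 NL]]].
  have := key N N1 (fun _ => id).
  rewrite A0 => /(_ (fun _ => False_ind _) 0 (rpred0 _)) [].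
exists L => //; split; first by exists 1.
move=> L' LL' [y yL'] x xL'.
suff: A x by rewrite AE.
apply: (key L') => //.
- by apply: contra yL' => L'1; rewrite -[y]mulr1 (@rpredZ R R^o L').
- by move=> z /NL/LL'.
by move=> z; rewrite AE; exact: LL'.
Qed.

Lemma jacobsonP (R : pzRingType) (x : R) :
  x \in jacobson R <-> forall a : R, exists u : R, u * (1 - a * x) = 1.
Proof.
split=> [/asboolP Jx a|linv].
  have [|no1] := boolP ((1 : R) \in principal (1 - a * x)).
    by move=> /asboolP[u uE]; exists u.
  have [L maxL NL] := exists_maximal (N := principal (1 - a * x)) no1.
  have xL : a * x \in L by exact: (@rpredZ R R^o L a x (Jx _ maxL)).
  case: maxL => -[y /negP yL] _; case: yL.
  have : (1 : R) \in L.
    rewrite -(subrK (a * x) 1); apply: (@rpredD R^o L) => //.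
    by apply: NL; apply/asboolP; exists 1; rewrite mul1r.
  by move=> /(@rpredZ R R^o L y); rewrite /GRing.scale /= mulr1.
apply/asboolP => N [[y yN] maxN]; apply: contrapT => /negP xN.
pose P : {pred R^o} := fun z => `[< exists n, n \in N /\ exists a : R, z = n + a * x >].
have Pc : submod_closed P.
  split=> [|b _ _ /asboolP[n [nN [a ->]]] /asboolP[m [mN [c ->]]]]; apply/asboolP.
    by exists 0; split; [exact: rpred0|exists 0; rewrite mul0r addr0].
  exists (b *: n + m); split; first by rewrite rpredD ?rpredZ.
  exists (b * a + c); rewrite scalerDr mulrDl addrACA; congr (_ + (_ + _)).
  by rewrite -mulrA.
pose L : submodClosed R^o := HB.pack P (GRing.isSubmodClosed.Build R R^o P Pc).
have xL : x \in L.
  by apply/asboolP; exists 0; split; [exact: rpred0|exists 1; rewrite mul1r add0r].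
have NL : {subset N <= L}.
  by move=> z zN; apply/asboolP; exists z; split=> //; exists 0; rewrite mul0r addr0.
have : (1 : R) \in L.
  apply: contrapT => /negP L1; move/negP: xN; apply; apply: (maxN L) => //.
  by exists 1.
move=> /asboolP[n [nN [a /eqP]]]; rewrite -subr_eq => /eqP nE.
have [u u1] := linv a; move: yN; rewrite -[y]mulr1 -u1 nE mulrA => /negP; apply.
exact: (@rpredZ R R^o N).
Qed.

Lemma jacobson_converse_sub (R : pzRingType) (x : R) :
  x \in jacobson R -> x \in jacobson R^c.
Proof.
move=> /jacobsonP Jx; apply/jacobsonP.
suff rinv (a : R) : exists v : R, (1 - x * a) * v = 1 by exact: rinv.
have [u u1] := Jx a.
have ux : u = 1 + u * (a * x).
  by rewrite -{1}u1 -mulrDr subrK mulr1.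
have [w w1] := Jx (- u * a); move: w1.
rewrite mulNr mulNr opprK -mulrA -ux => w1.
have wE : w = 1 - a * x.
  by have := congr1 ( *%R w) u1; rewrite mulrA w1 mul1r mulr1.
rewrite wE in w1.
exists (1 + x * u * a).
have e : (1 - x * a) * x = x * (1 - a * x).
  by rewrite mulrBl mulrBr mul1r mulr1 !mulrA.
by rewrite mulrDr mulr1 !mulrA e -(mulrA x) w1 mulr1 subrK.
Qed.

Lemma jacobson_converse (R : pzRingType) (x : R) :
  (x \in jacobson R^c) = (x \in jacobson R).
Proof.
apply/idP/idP; last exact: jacobson_converse_sub.
move=> /(@jacobson_converse_sub R^c) /jacobsonP Jx; apply/jacobsonP => a.
exact: Jx.
Qed.

End JacobsonConverse.

Section Rings.
Variable R : pzRingType.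

Definition right_ideal (a : R) : lmodType R^c := @left_ideal R^c a.

(* Unique maximal left ideal, whence R != 0. *)
Definition local_ring :=
  exists2 N : submodClosed R^o, maximal_sub N &
    forall L : submodClosed R^o, maximal_sub L -> L =i N.

Definition essential_socles :=
  essential_sub (@socle R^c (R^c)^o) /\ essential_sub (@socle R R^o).

Definition artinian_ring :=
  artinian_module (R^c)^o /\ artinian_module R^o.

Definition pseudo_frobenius :=
  (injective_module (R^c)^o /\ cogenerator (R^c)^o) /\
  (injective_module R^o /\ cogenerator R^o).

Section Idempotents.
Variables (I : finType) (eps : I -> R).

Definition basic :=
  forall i j, i != j -> ~ mod_iso (right_ideal (eps i)) (right_ideal (eps j)).

(* The notion is defined for basic rings only, so basicness is part of it. *)
Definition nakayama_permutation (p : {perm I}) :=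
  basic /\
  forall i,
    mod_iso (soc_module (right_ideal (eps i)))
            (top_module (right_ideal (eps (p i)))) /\
    mod_iso (soc_module (left_ideal (eps (p i))))
            (top_module (left_ideal (eps i))).

(* Relative to eps, as Nakayama permutations are. *)
Definition quasi_frobenius :=
  artinian_ring /\ exists p, nakayama_permutation p.

End Idempotents.
End Rings.

Section Corner.
Variables (R : pzRingType) (e : R).

Definition corner_pred : {pred R} := fun x => e * x * e == x.

Lemma corner_zmod_closed : zmod_closed corner_pred.
Proof.
split=> [|x y /eqP xE /eqP yE]; first by rewrite unfold_in mulr0 mul0r.
by rewrite unfold_in mulrBr mulrBl xE yE.
Qed.

HB.instance Definition _ :=
  GRing.isZmodClosed.Build R corner_pred corner_zmod_closed.

(* The ring e R e for an idempotent e; its identity is e. *)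
Record corner (ee : e * e = e) :=
  Corner { corner_val : R; _ : corner_val \in corner_pred }.

Variable ee : e * e = e.
Local Notation eRe := (corner ee).

HB.instance Definition _ := [isSub for @corner_val ee].
HB.instance Definition _ := [Choice of eRe by <:].
HB.instance Definition _ := [SubChoice_isSubZmodule of eRe by <:].

Lemma corner_mulel (x : eRe) : e * val x = val x.
Proof. by case: x => x /= /eqP <-; rewrite !mulrA ee. Qed.

Lemma corner_muler (x : eRe) : val x * e = val x.
Proof. by case: x => x /= /eqP <-; rewrite -!mulrA ee. Qed.

Lemma corner_one_subproof : e \in corner_pred.
Proof. by rewrite unfold_in !ee. Qed.

Lemma corner_mul_subproof (x y : eRe) : val x * val y \in corner_pred.
Proof. by rewrite unfold_in mulrA corner_mulel -mulrA corner_muler. Qed.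

Definition corner_one : eRe := Corner ee corner_one_subproof.
Definition corner_mul (x y : eRe) : eRe := Corner ee (corner_mul_subproof x y).

Lemma corner_mulA : associative corner_mul.
Proof. by move=> x y z; apply/val_inj/mulrA. Qed.
Lemma corner_mul1 : left_id corner_one corner_mul.
Proof. by move=> x; apply/val_inj/corner_mulel. Qed.
Lemma corner_mulr1 : right_id corner_one corner_mul.
Proof. by move=> x; apply/val_inj/corner_muler. Qed.
Lemma corner_mulDl : left_distributive corner_mul +%R.
Proof. by move=> x y z; apply/val_inj/mulrDl. Qed.
Lemma corner_mulDr : right_distributive corner_mul +%R.
Proof. by move=> x y z; apply/val_inj/mulrDr. Qed.

HB.instance Definition _ := GRing.Zmodule_isPzRing.Build eRe
  corner_mulA corner_mul1 corner_mulr1 corner_mulDl corner_mulDr.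

End Corner.

Record bimodule (R S : pzRingType) := Bimodule {
  bimod_sort :> lmodType R;
  ract : bimod_sort -> S -> bimod_sort;
  ractDl : forall b c s, ract (b + c) s = ract b s + ract c s;
  ractDr : forall b s t, ract b (s + t) = ract b s + ract b t;
  ractA : forall b s t, ract (ract b s) t = ract b (s * t);
  ract1 : forall b, ract b 1 = b;
  ractZ : forall r b s, ract (r *: b) s = r *: ract b s
}.

Section FormalMatrices.
Variable n : nat.

(* [fm_id] identifies R_i with the bimodule B_{i,i}. A bimodule homomorphism out
   of a tensor product over R_j is given as an R_j-balanced biadditive map [fm_mul]
   that is linear for the outer left and right actions. *)
Record formal_matrix_data := FormalMatrixData {
  fm_ring : 'I_n -> pzRingType;
  fm_local : forall i, local_ring (fm_ring i);
  fm_bimod : forall i j, bimodule (fm_ring i) (fm_ring j);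
  fm_id : forall i, fm_ring i -> fm_bimod i i;
  fm_id_bij : forall i, bijective (@fm_id i);
  fm_idD : forall i, {morph @fm_id i : r s / r + s};
  fm_idZ : forall i (r s : fm_ring i), fm_id (r * s) = r *: fm_id s;
  fm_idM : forall i (r s : fm_ring i), fm_id (r * s) = ract (fm_id r) s;
  fm_mul : forall i j k, fm_bimod i j -> fm_bimod j k -> fm_bimod i k;
  fm_mulDl : forall i j k (a b : fm_bimod i j) (c : fm_bimod j k),
    fm_mul (a + b) c = fm_mul a c + fm_mul b c;
  fm_mulDr : forall i j k (a : fm_bimod i j) (b c : fm_bimod j k),
    fm_mul a (b + c) = fm_mul a b + fm_mul a c;
  fm_mul_balanced :
    forall i j k (a : fm_bimod i j) (r : fm_ring j) (b : fm_bimod j k),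
      fm_mul (ract a r) b = fm_mul a (r *: b);
  fm_mulZ : forall i j k (r : fm_ring i) (a : fm_bimod i j) (b : fm_bimod j k),
    fm_mul (r *: a) b = r *: fm_mul a b;
  fm_mul_ract :
    forall i j k (a : fm_bimod i j) (b : fm_bimod j k) (r : fm_ring k),
      fm_mul a (ract b r) = ract (fm_mul a b) r;
  fm_mul_idl : forall i j (r : fm_ring i) (b : fm_bimod i j),
    fm_mul (fm_id r) b = r *: b;
  fm_mul_idr : forall i j (a : fm_bimod i j) (r : fm_ring j),
    fm_mul a (fm_id r) = ract a r;
  fm_mulA : forall i j k l (a : fm_bimod i j) (b : fm_bimod j k)
                   (c : fm_bimod k l),
    fm_mul (fm_mul a b) c = fm_mul a (fm_mul b c)
}.

Variable D : formal_matrix_data.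

Definition formal_matrix := {dffun forall ij : 'I_n * 'I_n, fm_bimod D ij.1 ij.2}.
HB.instance Definition _ := Choice.on formal_matrix.

Definition entry (A : formal_matrix) i j : fm_bimod D i j := A (i, j).

Definition mk_matrix (f : forall i j, fm_bimod D i j) : formal_matrix :=
  [ffun ij : 'I_n * 'I_n => f ij.1 ij.2 : fm_bimod D ij.1 ij.2].

Lemma mk_matrixE f i j : entry (mk_matrix f) i j = f i j.
Proof. by rewrite /entry ffunE. Qed.

Lemma matrix_ext (A B : formal_matrix) :
  (forall i j, entry A i j = entry B i j) -> A = B.
Proof. by move=> AB; apply/ffunP => -[i j]; exact: AB. Qed.

Definition fm_zero : formal_matrix := mk_matrix (fun i j => 0).
Definition fm_opp A := mk_matrix (fun i j => - entry A i j).
Definition fm_add A B := mk_matrix (fun i j => entry A i j + entry B i j).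

Lemma fm_addA : associative fm_add.
Proof. by move=> A B C; apply: matrix_ext => i j; rewrite !mk_matrixE addrA. Qed.
Lemma fm_addC : commutative fm_add.
Proof. by move=> A B; apply: matrix_ext => i j; rewrite !mk_matrixE addrC. Qed.
Lemma fm_add0 : left_id fm_zero fm_add.
Proof. by move=> A; apply: matrix_ext => i j; rewrite !mk_matrixE add0r. Qed.
Lemma fm_addN : left_inverse fm_zero fm_opp fm_add.
Proof. by move=> A; apply: matrix_ext => i j; rewrite !mk_matrixE addNr. Qed.

HB.instance Definition _ :=
  GRing.isZmodule.Build formal_matrix fm_addA fm_addC fm_add0 fm_addN.

Lemma entryD A B i j : entry (A + B) i j = entry A i j + entry B i j.
Proof. exact: mk_matrixE. Qed.

(* The diagonal matrix with diagonal entries d i; off the diagonal the entry is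
   0, and on it d i is transported along the equality of the two indices. *)
Definition fm_diag (d : forall i, fm_ring D i) : formal_matrix :=
  mk_matrix (fun i j =>
    match i =P j with
    | ReflectT ij => ecast k (fm_bimod D i k) ij (fm_id (d i))
    | ReflectF _ => 0
    end).

Definition fm_matmul (A B : formal_matrix) :=
  mk_matrix (fun i k => \sum_j fm_mul (entry A i j) (entry B j k)).

Lemma fm_mul0l i j k (b : fm_bimod D j k) : fm_mul (0 : fm_bimod D i j) b = 0.
Proof. by apply: (addrI (fm_mul 0 b)); rewrite -fm_mulDl !addr0. Qed.

Lemma fm_mul0r i j k (a : fm_bimod D i j) : fm_mul a (0 : fm_bimod D j k) = 0.
Proof. by apply: (addrI (fm_mul a 0)); rewrite -fm_mulDr !addr0. Qed.

Lemma fm_mul_suml i j k (J : finType) (F : J -> fm_bimod D i j)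
    (b : fm_bimod D j k) :
  fm_mul (\sum_x F x) b = \sum_x fm_mul (F x) b.
Proof.
apply: (big_morph (fun a : fm_bimod D i j => fm_mul a b)) => [x y|].
  exact: fm_mulDl.
exact: fm_mul0l.
Qed.

Lemma fm_mul_sumr i j k (J : finType) (a : fm_bimod D i j)
    (F : J -> fm_bimod D j k) :
  fm_mul a (\sum_x F x) = \sum_x fm_mul a (F x).
Proof.
apply: (big_morph (fun b : fm_bimod D j k => fm_mul a b)) => [x y|].
  exact: fm_mulDr.
exact: fm_mul0r.
Qed.

Lemma fm_diagE d i : entry (fm_diag d) i i = fm_id (d i).
Proof. by rewrite mk_matrixE; case: eqP => // p; rewrite eq_axiomK. Qed.

Lemma fm_diag0 d i j : i != j -> entry (fm_diag d) i j = 0.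
Proof. by rewrite mk_matrixE; case: eqP. Qed.

Lemma fm_mul_diagl d A i j :
  entry (fm_matmul (fm_diag d) A) i j = d i *: entry A i j.
Proof.
rewrite mk_matrixE (bigD1 i) //= fm_diagE fm_mul_idl big1 ?addr0 // => k ki.
by rewrite fm_diag0 1?eq_sym // fm_mul0l.
Qed.

Lemma fm_mul_diagr d A i j :
  entry (fm_matmul A (fm_diag d)) i j = ract (entry A i j) (d j).
Proof.
rewrite mk_matrixE (bigD1 j) //= fm_diagE fm_mul_idr big1 ?addr0 // => k kj.
by rewrite fm_diag0 // fm_mul0r.
Qed.

Definition fm_one := fm_diag (fun=> 1).

Lemma fm_matmulA : associative fm_matmul.
Proof.
move=> A B C; apply: matrix_ext => i l; rewrite !mk_matrixE.
under eq_bigr do rewrite mk_matrixE fm_mul_sumr.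
under [RHS]eq_bigr do rewrite mk_matrixE fm_mul_suml.
rewrite exchange_big; do 2!apply: eq_bigr => ? _.
by rewrite fm_mulA.
Qed.

Lemma fm_matmul1 : left_id fm_one fm_matmul.
Proof. by move=> A; apply: matrix_ext => i j; rewrite fm_mul_diagl scale1r. Qed.

Lemma fm_matmulr1 : right_id fm_one fm_matmul.
Proof. by move=> A; apply: matrix_ext => i j; rewrite fm_mul_diagr ract1. Qed.

Lemma fm_matmulDl : left_distributive fm_matmul +%R.
Proof.
move=> A B C; apply: matrix_ext => i k; rewrite entryD !mk_matrixE -big_split.
by apply: eq_bigr => j _; rewrite entryD fm_mulDl.
Qed.

Lemma fm_matmulDr : right_distributive fm_matmul +%R.
Proof.
move=> A B C; apply: matrix_ext => i k; rewrite entryD !mk_matrixE -big_split.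
by apply: eq_bigr => j _; rewrite entryD fm_mulDr.
Qed.

HB.instance Definition _ := GRing.Zmodule_isPzRing.Build formal_matrix
  fm_matmulA fm_matmul1 fm_matmulr1 fm_matmulDl fm_matmulDr.

Definition canonical_idem (i : 'I_n) : formal_matrix :=
  fm_diag (fun k => (k == i)%:R).

Lemma canonical_idemM i j :
  canonical_idem i * canonical_idem j =
  if i == j then canonical_idem i else 0.
Proof.
apply: matrix_ext => k l; rewrite fm_mul_diagl.
have entry0 : entry (0 : formal_matrix) k l = 0 by exact: mk_matrixE.
have [<-|kl] := eqVneq k l; last first.
  by rewrite fm_diag0 // scaler0; case: eqP => _; rewrite ?fm_diag0 ?entry0.
have id0 : fm_id (0 : fm_ring D k) = 0.
  by apply: (addrI (fm_id 0)); rewrite -fm_idD !addr0.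
rewrite fm_diagE; have [ki|ki] := eqVneq k i; last first.
  rewrite scale0r; case: eqP => _; last by rewrite mk_matrixE.
  by rewrite fm_diagE (negPf ki) id0.
subst i; rewrite scale1r; have [_|_] := eqVneq k j; last by rewrite id0 mk_matrixE.
by rewrite fm_diagE eqxx.
Qed.

Section SubsetOfIndices.
Variable I : {set 'I_n}.

Definition idem_sum : formal_matrix := \sum_(i in I) canonical_idem i.

Lemma idem_suml i : i \in I -> idem_sum * canonical_idem i = canonical_idem i.
Proof.
move=> iI; rewrite mulr_suml (bigD1 i) //= canonical_idemM eqxx big1 ?addr0 //.
by move=> j /andP[_ /negPf ji]; rewrite canonical_idemM ji.
Qed.

Lemma idem_sumr i : i \in I -> canonical_idem i * idem_sum = canonical_idem i.
Proof.
move=> iI; rewrite mulr_sumr (bigD1 i) //= canonical_idemM eqxx big1 ?addr0 //.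
by move=> j /andP[_ /negPf ji]; rewrite canonical_idemM eq_sym ji.
Qed.

Lemma idem_sumM : idem_sum * idem_sum = idem_sum.
Proof. by rewrite {2 3}/idem_sum mulr_sumr; apply: eq_bigr => i /idem_suml. Qed.

Lemma corner_idem_subproof (i : {i | i \in I}) :
  canonical_idem (val i) \in corner_pred idem_sum.
Proof.
by case: i => i iI; rewrite unfold_in /= idem_suml // idem_sumr.
Qed.

(* The idempotents e_i, i in I, as elements of e R e. *)
Definition corner_idem (i : {i | i \in I}) : corner idem_sumM :=
  Corner idem_sumM (corner_idem_subproof i).

Variables (p : {perm 'I_n}) (pI : forall i, i \in I -> p i \in I).

Definition perm_restr_fun (i : {i | i \in I}) : {i | i \in I} :=
  exist _ (p (val i)) (pI (valP i)).

Lemma perm_restr_inj : injective perm_restr_fun.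
Proof. by move=> i j /(congr1 val) /perm_inj /val_inj. Qed.

Definition perm_restr : {perm {i | i \in I}} := perm perm_restr_inj.

End SubsetOfIndices.
End FormalMatrices.

(* Main.v *)
Require Import Defs.
From mathcomp Require Import all_boot perm all_algebra.
From HB Require Import structures.
From mathcomp Require Import boolp.

(**
Write g = e_i and f = e_(pi i). The left half of the Nakayama condition, with
essential left socle, amounts to a statement about elements ([socle_link]):
there is a nonzero t in g R f that lies in R x for every nonzero x in R f.
Then R t is simple, it is the socle of R f, it is essential in R f, and because
g is a local idempotent R t is isomorphic to top(R g). The lemmas
[socle_link_of_iso], [soc_top_iso] and [essential_socle] give the two
directions. The right half is the left half for the opposite ring, with g and f
exchanged, so everything below is proved for left modules only and then used
for R and for R^c.

If i and pi i both lie in I, then t lies in e R e, and r x = t with x in e R f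
implies (e r e) x = t. So the links with index in I are links of e R e
([socle_link_emb]); the idempotents e_i stay local and pairwise non-isomorphic.
This gives the Nakayama permutation and the essential socles of e R e.

Injectivity of e R e uses that no nonzero left submodule of R e is killed by e
([faithful_links]): a nonzero element of R e has a multiple t = g t with g = e_i
and i in I; a permutation of a finite set that maps I into I also maps the
complement into itself, so every index in I is some pi i with i in I. For an
e R e-module A let F(A) be the coinduced R-module Hom(e R, A), so that e F(A) is
A. The map from R e to F(e R e) that sends m to x |-> x m is then injective, and
it splits off because R is self-injective. Hence a map A -> e R e gives
F(A) -> F(e R e) -> R, which extends to F(B) when A is contained in B, and e
times this extension is the wanted map B -> e R e ([injective_emb]).

A self-injective ring with links for all its idempotents e_i is a cogenerator:
a nonzero x in a module has some e_i x nonzero, and e_i x |-> t is well defined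
on the cyclic module generated by e_i x, since the annihilator of e_i x in R e_i
is proper and so kills t ([cogenerator_of_injective]). Finally a left ideal N of
e R e is the intersection with e R e of the left ideal of all y with e R y e
contained in N, so descending chains of e R e lift to R ([artinian_emb]).
*)

Set Implicit Arguments.
Unset Strict Implicit.
Unset Printing Implicit Defensive.

Import GRing.Theory.
Local Open Scope ring_scope.

(** * Cyclic modules *)

Lemma linear_from_cyclic (R : pzRingType) (M N : lmodType R) (m : M) (n : N) :
  (forall x : M, exists r : R, x = r *: m) ->
  (forall r : R, r *: m = 0 -> r *: n = 0) ->
  exists f : {linear M -> N}, f m = n.
Proof.
move=> gen ann.
pose c x := projT1 (cid (gen x)).
have cE x : x = c x *: m := projT2 (cid (gen x)).
pose f x := c x *: n.
have fE r x : x = r *: m -> f x = r *: n.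
  move=> xE; apply/eqP; rewrite -subr_eq0 -scalerBl; apply/eqP/ann.
  by rewrite scalerBl -cE -xE subrr.
have lin_f : linear f.
  move=> r x y; rewrite (fE (r * c x + c y)).
    by rewrite scalerDl -scalerA.
  by rewrite scalerDl -scalerA -!cE.
pose g : {linear M -> N} := HB.pack f (GRing.isLinear.Build R M N _ f lin_f).
by exists g; rewrite /= (fE 1) ?scale1r.
Qed.

Lemma mod_iso_cyclic (R : pzRingType) (M N : lmodType R) (m : M) (n : N) :
  (forall x : M, exists r : R, x = r *: m) ->
  (forall y : N, exists r : R, y = r *: n) ->
  (forall r : R, r *: m = 0 <-> r *: n = 0) ->
  mod_iso M N.
Proof.
move=> genM genN ann.
have [f fm] := linear_from_cyclic genM (fun r => (ann r).1).
have [g gn] := linear_from_cyclic genN (fun r => (ann r).2).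
exists f; exists g => [x|y].
  by have [r ->] := genM x; rewrite !linearZ /= fm gn.
by have [r ->] := genN y; rewrite !linearZ /= gn fm.
Qed.

(** * The left ideal of an idempotent, its top and its socle *)

Lemma jacobson_mulr (R : pzRingType) (x r : R) :
  x \in jacobson R -> x * r \in jacobson R.
Proof.
by rewrite -!jacobson_converse => Jx; exact: (@rpredZ R^c (R^c)^o (jacobson R^c) r x).
Qed.

Section LeftIdeal.
Variables (R : pzRingType) (f : R).

Lemma mul_principal (x : R) : x * f \in principal f.
Proof. by apply/asboolP; exists x. Qed.

(** When f is idempotent, [rmul] retracts R onto R f. All elements of R f, of its
    socle and of its top are handled as elements of R through this map. *)
Definition rmul (x : R^o) : left_ideal f := Submodule (mul_principal x).

Lemma rmul_linear : linear rmul.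
Proof. by move=> a x y; apply: val_inj; rewrite /= mulrDl -mulrA. Qed.

HB.instance Definition _ :=
  GRing.isLinear.Build R R^o (left_ideal f) _ rmul rmul_linear.

Lemma rmul_surj (y : left_ideal f) : exists x, y = rmul x.
Proof. by case: y => y yf; have /asboolP[x yE] := yf; exists x; apply: val_inj. Qed.

Lemma rmulZ (r x : R) : r *: rmul x = rmul (r * x).
Proof. by rewrite -linearZ. Qed.

Lemma rmul_eq0 (x : R) : rmul x = 0 <-> x * f = 0.
Proof. by split=> [/(congr1 val)//|xf]; apply: val_inj. Qed.

Lemma rmul_val (y : left_ideal f) : f * f = f -> rmul (val y) = y.
Proof.
by move=> ff; have [x ->] := rmul_surj y; apply: val_inj; rewrite /= -mulrA ff.
Qed.

Definition top_proj (x : R) : top_module (left_ideal f) :=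
  quot_proj (@ideal_mul R (jacobson R) (left_ideal f)) (rmul x).

Lemma top_projZ (r x : R) : r *: top_proj x = top_proj (r * x).
Proof. by rewrite [LHS]quot_scaleE rmulZ. Qed.

Lemma top_proj_surj (y : top_module (left_ideal f)) : exists x, y = top_proj x.
Proof.
rewrite -(quot_proj_repr y); have [x xE] := rmul_surj (repr y).
by exists x; rewrite [RHS]/top_proj -xE.
Qed.

Lemma top_proj_eq0 (x : R) : f * f = f -> top_proj x = 0 <-> x * f \in jacobson R.
Proof.
move=> ff; have top0 : top_proj 0 = 0 by rewrite -(mul0r 0) -top_projZ scale0r.
have subE : rmul x - rmul 0 = rmul x by rewrite linear0 subr0.
rewrite -top0; apply: (iff_trans (quot_projP _ _ _)); rewrite subE.
split=> [/asboolP[s sJ /(congr1 val) /= ->]|xJ]; last first.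
  apply/asboolP; exists [:: (x * f, rmul 1)] => [p|].
    by rewrite inE => /eqP ->.
  by rewrite big_seq1 /= rmulZ mulr1; apply: val_inj; rewrite /= -mulrA ff.
have valsum (t : seq (R * left_ideal f)) :
    val (\sum_(p <- t) p.1 *: p.2) = \sum_(p <- t) p.1 * val p.2.
  by elim: t => [|p t IH]; rewrite ?big_nil // !big_cons -IH.
rewrite valsum big_seq; apply: (@rpred_sum R^o (jacobson R)) => p /sJ.
exact: jacobson_mulr.
Qed.

End LeftIdeal.

(** A simple submodule has zero or simple image. Used with right multiplication
    by f, this identifies the socle of R f with the intersection of R f and the
    socle of R, without any theory of semisimple modules. *)
Lemma socle_linear (R : pzRingType) (M N : lmodType R) (h : {linear M -> N}) x :
  x \in @socle R M -> h x \in @socle R N.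
Proof.
move=> /asboolP[s sS ->]; rewrite linear_sum big_seq.
apply: rpred_sum => y /sS[S [[z zS z0] minS] yS].
have [->|hy0] := eqVneq (h y) 0; first exact: rpred0.
pose P : {pred N} := fun v => `[< exists2 u, u \in S & v = h u >].
have Pc : submod_closed P.
  split=> [|a _ _ /asboolP[u uS ->] /asboolP[v vS ->]]; apply/asboolP.
    by exists 0; rewrite ?rpred0 ?linear0.
  by exists (a *: u + v); rewrite ?linearP // rpredD ?rpredZ.
pose hS : submodClosed N := HB.pack P (GRing.isSubmodClosed.Build R N P Pc).
have hyS : h y \in hS by apply/asboolP; exists y.
apply/asboolP; exists [:: h y]; last by rewrite big_seq1.
move=> _ /[!inE] /eqP ->; exists hS => //; split; first by exists (h y).
move=> L LhS [v vL v0].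
pose Q : {pred M} := fun u => (u \in S) && (h u \in L).
have Qc : submod_closed Q.
  split=> [|a u w /andP[uS uL] /andP[wS wL]]; rewrite unfold_in.
    by rewrite linear0 !rpred0.
  by rewrite linearP !rpredD ?rpredZ.
pose K : submodClosed M := HB.pack Q (GRing.isSubmodClosed.Build R M Q Qc).
have /asboolP[u uS vE] := LhS _ vL.
have SK : {subset S <= K}.
  apply: minS => [w /andP[]//|]; exists u; first by apply/andP; rewrite -vE.
  by apply: contraNneq v0 => u0; rewrite vE u0 linear0.
by move=> _ /asboolP[w /SK/andP[_ wL] ->].
Qed.

(** * Local idempotents and simple tops *)

(** For g in the radical, 1 - g has a left inverse, and 1 - g kills g. *)
Lemma idem_jacobson (R : pzRingType) (g : R) :
  g * g = g -> g \in jacobson R -> g = 0.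
Proof.
move=> gg /jacobsonP /(_ 1) [u u1].
by rewrite -[g]mul1r -u1 -mulrA mul1r mulrBl mul1r gg subrr mulr0.
Qed.

(** This says that g R g is a local ring. The inverse v may be any element of R,
    which keeps the definition invariant under passage to a corner ring and to
    the opposite ring; g v g is then an inverse in g R g. *)
Definition local_idem (R : pzRingType) (g : R) :=
  [/\ g * g = g, g != 0 &
    forall u, g * u * g = u -> exists v,
      (v * u = g /\ u * v = g) \/ (v * (g - u) = g /\ (g - u) * v = g)].

Lemma local_idem_op (R : pzRingType) (g : R) :
  local_idem g -> @local_idem R^c g.
Proof.
case=> gg g0 loc; split=> // u uE.
have [|v vE] := loc u; first by rewrite -mulrA.
by exists v; case: vE => -[? ?]; [left|right].
Qed.

(** The elementwise form of the simplicity of top(R g). If g a r g is invertible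
    in g R g for some a, then g is a multiple of r g. Otherwise g - g a r g is
    always invertible there, and its inverse yields a left inverse of 1 - a r g,
    so that r g is in the radical. *)
Lemma local_top (R : pzRingType) (g r : R) :
  local_idem g -> r * g \in jacobson R \/ exists q, q * r * g = g.
Proof.
move=> [gg g0 loc].
have [q_ex|noq] := pselect (exists q, q * r * g = g); [by right|left].
apply/jacobsonP => a; have [w wE] : exists w, w = a * (r * g) by exists (a * (r * g)).
have wg : w * g = w by rewrite wE -!mulrA gg.
have [|v [[vu _]|[vu _]]] := loc (g * w); first by rewrite mulrA gg -mulrA wg.
  by case: noq; exists (v * g * a); rewrite -[RHS]vu wE !mulrA.
(* As for 1 - x y and 1 - y x: a left inverse of 1 - w g is built from the
   inverse v of g - g w g, and here w g = w. *)
rewrite -wE; exists (1 + w * v * g).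
have vwE : v * (g * w) = v * g - g.
  move/eqP: vu; rewrite mulrBr subr_eq => /eqP ->.
  by rewrite addrAC subrr add0r.
have -> : w * v * g = w * (v * g) by rewrite mulrA.
rewrite mulrBr mulr1 mulrDl mul1r -!mulrA vwE mulrBr wg.
by rewrite [w + _]addrC subrK addrK.
Qed.

(** * Socles of the left ideals of idempotents *)

(** For idempotents f and g, with g local, the elementwise content of soc(R f)
    being isomorphic to top(R g) and essential in R f: the element t generates the
    socle of R f, and g t = t makes R t a quotient of R g. *)
Definition socle_link (R : pzRingType) (g f : R) :=
  exists2 t, [/\ g * t = t, t * f = t & t != 0] &
    forall x, x * f = x -> x != 0 -> exists r, r * x = t.

Section SocleElements.
Variables (R : pzRingType) (f : R).

Definition soc_elt (z : soc_module (left_ideal f)) : R :=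
  submod_val (submod_val z).

Lemma soc_elt_inj : injective soc_elt.
Proof. by move=> y z yz; do 2!apply: val_inj. Qed.

Lemma soc_eltZ r z : soc_elt (r *: z) = r * soc_elt z.
Proof. by []. Qed.

Lemma soc_elt0 : soc_elt 0 = 0.
Proof. by []. Qed.

Lemma soc_elt_mulr z : f * f = f -> soc_elt z * f = soc_elt z.
Proof. by move=> ff; rewrite -[LHS]/(val (rmul f (soc_elt z))) rmul_val. Qed.

Lemma soc_elt_surj x :
  x * f = x -> (x : R^o) \in @socle R R^o -> exists z, soc_elt z = x.
Proof.
by move=> xf xsoc; exists (Submodule (socle_linear (rmul f) xsoc)).
Qed.

End SocleElements.

(** The generator t is the element of soc(R f) that corresponds to the class of g
    in top(R g). For x nonzero in R f, essentiality gives a nonzero y in both R x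
    and the socle; its image in top(R g) is nonzero, hence has the class of g as
    a multiple, and so y has t as a multiple. *)
Lemma socle_link_of_iso (R : pzRingType) (g f : R) :
  local_idem g -> f * f = f -> essential_sub (@socle R R^o) ->
  mod_iso (soc_module (left_ideal f)) (top_module (left_ideal g)) ->
  socle_link g f.
Proof.
move=> locg ff ess [phi [psi phiK psiK]]; have [gg g0 _] := locg.
have phi_inj := can_inj phiK.
have [s phis] : exists s, phi s = top_proj g 1 by exists (psi (top_proj g 1)).
have top_g (x y : R) : x * g = y * g -> top_proj g x = top_proj g y.
  by move=> xy; congr quot_proj; apply: val_inj.
exists (soc_elt s).
  split; last 1 first.
  - apply: contra_neq g0; rewrite -(soc_elt0 f) => /soc_elt_inj s0.
    apply: idem_jacobson => //; rewrite -[g in g \in _]mul1r.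
    by apply/top_proj_eq0; rewrite // -phis s0 linear0.
  - rewrite -soc_eltZ; congr soc_elt; apply: phi_inj.
    by rewrite linearZ /= phis top_projZ; apply: top_g; rewrite mulr1 gg mul1r.
  exact: soc_elt_mulr.
move=> x xf x0.
have [|y /andP[/asboolP[a yE] ysoc] y0] := ess (principal x).
  by exists x => //; apply/asboolP; exists 1; rewrite mul1r.
have yf : y * f = y by rewrite yE -mulrA xf.
have [z zy] := @soc_elt_surj R f y yf ysoc.
have [b bE] := top_proj_surj (phi z).
have [bJ|[q qE]] := local_top b locg.
  have z0 : z = 0 by apply: phi_inj; rewrite linear0 bE; apply/top_proj_eq0.
  by case/eqP: y0; rewrite -zy z0.
exists (q * a); rewrite -mulrA -yE -zy -soc_eltZ; congr soc_elt.
apply: phi_inj; rewrite linearZ /= bE phis top_projZ.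
by apply: top_g; rewrite mul1r.
Qed.

Section SocleLink.
Variables (R : pzRingType) (f t : R).
Hypotheses (ff : f * f = f) (tf : t * f = t) (t0 : t != 0).
Hypothesis tmin : forall x, x * f = x -> x != 0 -> exists r, r * x = t.

(** A nonzero submodule of R t lies in R f, so it contains t: R t is simple. *)
Lemma link_socle : (t : R^o) \in @socle R R^o.
Proof.
have tt : t \in principal t by apply/asboolP; exists 1; rewrite mul1r.
apply/asboolP; exists [:: (t : R^o)]; last by rewrite big_seq1.
move=> _ /[!inE] /eqP ->; pose Rt : submodClosed R^o := principal t.
exists Rt => //; split; first by exists t.
move=> L Lt [y yL y0] _ /asboolP[c ->].
have [|r <-] := tmin _ y0.
  by have /asboolP[a ->] := Lt _ yL; rewrite -mulrA tf.
by rewrite mulrA; exact: (@rpredZ R R^o L (c * r) y).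
Qed.

(** A simple submodule of R f contains t, hence is contained in R t. *)
Lemma link_socle_gen (y : left_ideal f) :
  y \in @socle R (left_ideal f) -> exists r, y = r *: rmul f t.
Proof.
move=> /asboolP[s sS ->].
pose P : {pred left_ideal f} := fun v => `[< exists r, v = r *: rmul f t >].
have Pc : submod_closed P.
  split=> [|a _ _ /asboolP[r ->] /asboolP[c ->]]; apply/asboolP.
    by exists 0; rewrite scale0r.
  by exists (a * r + c); rewrite scalerDl scalerA.
pose L : submodClosed (left_ideal f) :=
  HB.pack P (GRing.isSubmodClosed.Build R (left_ideal f) P Pc).
suff /asboolP : \sum_(y <- s) y \in L by [].
rewrite big_seq; apply: rpred_sum => {}y /sS[N [[z zN z0] minN] yN].
have [||r rz] := tmin (x := val z).
- by rewrite -[LHS]/(val (rmul f (val z))) rmul_val.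
- by apply: contra_neq z0 => z0; apply: val_inj.
have tN : rmul f t \in N.
  have -> : rmul f t = r *: z by apply: val_inj; rewrite /= tf.
  exact: rpredZ.
apply: (minN L) => //.
  by move=> _ /asboolP[a ->]; rewrite rpredZ.
exists (rmul f t); first by apply/asboolP; exists 1; rewrite scale1r.
by apply: contra_neq t0 => /rmul_eq0; rewrite tf.
Qed.

End SocleLink.

(** Both modules are cyclic, so it suffices that t and the class of g have the
    same annihilator. If r g is in the radical, then so are the q r g with
    q r t = t, which forces t = 0; if not, then t is a multiple of r t. *)
Lemma soc_top_iso (R : pzRingType) (g f : R) :
  local_idem g -> f * f = f -> socle_link g f ->
  mod_iso (soc_module (left_ideal f)) (top_module (left_ideal g)).
Proof.
move=> locg ff [t [gt tf t0] tmin]; have [gg g0 _] := locg.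
have [m mt] := soc_elt_surj tf (link_socle tf t0 tmin).
apply: (@mod_iso_cyclic R _ _ m (top_proj g 1)).
- move=> x; have [r rE] := link_socle_gen ff tf t0 tmin (valP x).
  exists r; apply: soc_elt_inj; rewrite soc_eltZ mt.
  by rewrite -[LHS]/(val (val x)) rE /= tf.
- by move=> y; have [r ->] := top_proj_surj y; exists r; rewrite top_projZ mulr1.
move=> r.
have annm : (r *: m = 0) <-> (r * t = 0).
  split=> [rm|rt]; first by rewrite -mt -soc_eltZ rm.
  by apply: soc_elt_inj; rewrite soc_eltZ mt.
apply: (iff_trans annm).
rewrite top_projZ mulr1; split=> [rt|/(top_proj_eq0 _ gg) rJ].
  apply/top_proj_eq0 => //; have [//|[q qE]] := local_top r locg.
  by case/eqP: t0; rewrite -gt -qE -!mulrA gt rt mulr0.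
apply/eqP; apply: contraNT t0 => rt0; apply/eqP.
have [|q qt] := tmin _ _ rt0; first by rewrite -mulrA tf.
have /jacobsonP/(_ q)[u u1] := rJ.
by rewrite -[t]mul1r -u1 -mulrA mulrBl mul1r -!mulrA gt qt subrr mulr0.
Qed.

(** Given x nonzero in L, the components x (f i) are moved into the socle one at a
    time: left multiplication by a suitable r turns a nonzero component into the
    element t of its link, and components already in the socle stay there. *)
Lemma essential_socle (R : pzRingType) (I : finType) (f : I -> R) :
  \sum_i f i = 1 -> (forall i, f i * f i = f i) ->
  (forall i, exists g, socle_link g (f i)) ->
  essential_sub (@socle R R^o).
Proof.
move=> f1 idem link L [x xL x0].
suff [y [yL y0 ys]] : exists y : R, [/\ (y : R^o) \in L, y != 0 &
    forall i, i \in enum I -> ((y * f i : R) : R^o) \in @socle R R^o].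
  exists (y : R^o) => //; rewrite yL -[y]mulr1 -f1 mulr_sumr.
  by apply: rpred_sum => i _; rewrite ys ?mem_enum.
elim: (enum I) => [|i s [y [yL y0 ys]]]; first by exists x.
have [yi0|yi0] := eqVneq (y * f i) 0.
  exists y; split=> // j /[!inE] /orP[/eqP ->|/ys //].
  by rewrite yi0; exact: (rpred0 (@socle R R^o)).
have [g [t [_ tf t0] tmin]] := link i.
have [|r rt] := tmin _ _ yi0; first by rewrite -mulrA idem.
have tsoc := link_socle tf t0 tmin.
exists (r * y); split=> [||j /[!inE]].
- exact: (@rpredZ R R^o L).
- by apply: contra_neq t0 => ry0; rewrite -rt mulrA ry0 mul0r.
have [-> _|_ /ys yj] := eqVneq j i; first by rewrite -mulrA rt.
by rewrite -mulrA; exact: (@rpredZ R R^o (@socle R R^o) r).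
Qed.

(** * Corner rings *)

(** Isomorphism of R e and R f is witnessed by two elements of R, which can be
    moved between a corner ring and the whole ring. *)
Lemma left_ideal_isoP (R : pzRingType) (e f : R) :
  e * e = e -> f * f = f ->
  mod_iso (left_ideal e) (left_ideal f) <->
  exists a b, [/\ e * a = a, a * f = a, f * b = b & b * e = b] /\
              (a * b = e /\ b * a = f).
Proof.
move=> ee ff; split=> [[phi [psi phiK psiK]]|[a [b [[ea af fb be] [ab ba]]]]].
  have phi_inj := can_inj phiK.
  have phiE (x : R) : phi (rmul e x) = x *: (phi (rmul e 1) : left_ideal f).
    by rewrite -linearZ rmulZ mulr1.
  have [a0 a0E] := rmul_surj (phi (rmul e 1)).
  have [b0 b0E] := rmul_surj (psi (rmul f 1)).
  have phib0 : phi (rmul e b0) = rmul f 1 by rewrite -b0E psiK.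
  have eq_e (x y : R) : x * (a0 * f) = y * (a0 * f) -> x * e = y * e.
    move=> xy; have /phi_inj/(congr1 val) : phi (rmul e x) = phi (rmul e y).
      by rewrite phiE (phiE y) a0E !rmulZ; apply: val_inj; rewrite /= -!mulrA.
    by [].
  have b0a : b0 * (a0 * f) = f.
    by move: phib0; rewrite phiE a0E rmulZ => /(congr1 val) /=; rewrite mul1r mulrA.
  have ea : e * (a0 * f) = a0 * f.
    have : e *: (phi (rmul e 1) : left_ideal f) = phi (rmul e 1).
      by rewrite -phiE; congr (phi _); apply: val_inj; rewrite /= mul1r ee.
    by rewrite a0E rmulZ => /(congr1 val) /=; rewrite mulrA.
  have ba : b0 * e * (a0 * f) = f by rewrite -mulrA ea b0a.
  exists (a0 * f), (b0 * e); split; split=> //.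
  - by rewrite -mulrA ff.
  - by rewrite mulrA; apply: eq_e; rewrite -mulrA b0a ff.
  - by rewrite -mulrA ee.
  have : (a0 * f * b0) * e = 1 * e.
    by apply: eq_e; rewrite -(mulrA (a0 * f) b0) b0a mul1r -mulrA ff.
  by rewrite mul1r -mulrA.
apply: (@mod_iso_cyclic R _ _ (rmul e 1) (rmul f a)).
- by move=> x; have [y ->] := rmul_surj x; exists y; rewrite rmulZ mulr1.
- move=> x; have [y ->] := rmul_surj x; exists (y * b); rewrite rmulZ.
  by apply: val_inj; rewrite /= -(mulrA y) ba -mulrA ff.
move=> r; rewrite !rmulZ mulr1; split=> /rmul_eq0 r0; apply/rmul_eq0.
  by rewrite -mulrA af -ea mulrA r0 mul0r.
by rewrite -ab mulrA -af mulrA r0 mul0r.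
Qed.

(** An identification of E with e R e, where [p] is x |-> e x e. Unlike the type
    of corners it passes to opposite rings with the same maps, and it also covers
    the rings on the diagonal of a formal matrix ring. *)
Record corner_embedding (E R : pzRingType) (e : R) (iota : E -> R) (p : R -> E) :
    Prop := CornerEmbedding {
  emb_inj : injective iota;
  embD : forall x y, iota (x + y) = iota x + iota y;
  embM : forall x y, iota (x * y) = iota x * iota y;
  emb1 : iota 1 = e;
  emb_proj : forall x, iota (p x) = e * x * e
}.

Lemma corner_embedding_op (E R : pzRingType) (e : R) (iota : E -> R) p :
  corner_embedding e iota p -> @corner_embedding E^c R^c e iota p.
Proof.
case=> inj D M one proj; split=> //; first by move=> x y; exact: M.
by move=> x; rewrite proj -mulrA.
Qed.

Section CornerEmbedding.
Variables (E R : pzRingType) (e : R) (iota : E -> R) (p : R -> E).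
Hypothesis emb : corner_embedding e iota p.

Let iota_inj := emb_inj emb.
Let iotaM := embM emb.
Let iotaD := embD emb.
Let iota1 := emb1 emb.
Let iotap := emb_proj emb.

Lemma emb_mull c : e * iota c = iota c.
Proof. by rewrite -iota1 -iotaM mul1r. Qed.

Lemma emb_mulr c : iota c * e = iota c.
Proof. by rewrite -iota1 -iotaM mulr1. Qed.

Lemma emb_idem : e * e = e.
Proof. by rewrite -{1 3}iota1 emb_mulr. Qed.

Lemma emb0 : iota 0 = 0.
Proof. by apply: (addrI (iota 0)); rewrite -iotaD !addr0. Qed.

Lemma embB x y : iota (x - y) = iota x - iota y.
Proof. by apply: (addIr (iota y)); rewrite -iotaD !subrK. Qed.

Lemma emb_projK : cancel iota p.
Proof. by move=> c; apply: iota_inj; rewrite iotap emb_mull emb_mulr. Qed.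

Lemma emb_projD x y : p (x + y) = p x + p y.
Proof. by apply: iota_inj; rewrite iotaD !iotap mulrDr mulrDl. Qed.

Lemma emb_projMl c x : p (iota c * x) = c * p x.
Proof. by apply: iota_inj; rewrite iotaM !iotap !mulrA emb_mull emb_mulr. Qed.

Lemma emb_projMr x c : p (x * iota c) = p x * c.
Proof.
by apply: iota_inj; rewrite iotaM !iotap -!mulrA emb_mull emb_mulr.
Qed.

Lemma emb_proj_fix x : e * x * e = x -> iota (p x) = x.
Proof. by rewrite iotap. Qed.

Lemma local_idem_emb g : local_idem (iota g) <-> local_idem g.
Proof.
split=> -[gg g0 loc].
  split; first by apply: iota_inj; rewrite iotaM.
    by apply: contra_neq g0 => ->; exact: emb0.
  move=> u uE; have [|v vE] := loc (iota u); first by rewrite -!iotaM uE.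
  exists (p v); case: vE => -[vu uv]; [left|right]; split;
    by rewrite -?emb_projMr -?emb_projMl ?embB ?vu ?uv emb_projK.
have fixg (u : R) : iota g * u * iota g = u -> iota (p u) = u.
  move=> uE; apply: emb_proj_fix.
  by rewrite -uE !mulrA emb_mull -!mulrA emb_mulr.
split; first by rewrite -iotaM gg.
  by apply: contra_neq g0; rewrite -emb0 => /iota_inj.
move=> u uE; have [|v vE] := loc (p u).
  by rewrite -emb_projMl -emb_projMr uE.
exists (iota v); rewrite -(fixg u uE) -!embB -!iotaM.
by case: vE => -[-> ->]; [left|right].
Qed.

(** The element t = g t f is fixed by e on both sides, so it comes from E, and a
    multiplier r may be replaced by e r e. *)
Lemma socle_link_emb g f :
  socle_link (iota g) (iota f) -> socle_link g f.
Proof.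
move=> [t [gt tf t0] tmin].
have tE : iota (p t) = t.
  by apply: emb_proj_fix; rewrite -gt -tf !mulrA emb_mull -!mulrA emb_mulr.
exists (p t).
  split; [by rewrite -emb_projMl gt|by rewrite -emb_projMr tf|].
  by apply: contra_neq t0 => pt0; rewrite -tE pt0 emb0.
move=> x xf x0; have [||r rx] := tmin (iota x).
- by rewrite -iotaM xf.
- by apply: contra_neq x0; rewrite -emb0 => /iota_inj.
by exists (p r); rewrite -emb_projMr rx.
Qed.

Lemma left_ideal_iso_emb g f : g * g = g -> f * f = f ->
  mod_iso (left_ideal g) (left_ideal f) ->
  mod_iso (left_ideal (iota g)) (left_ideal (iota f)).
Proof.
move=> gg ff /left_ideal_isoP [//|//|a [b [[ga af fb bg] [ab ba]]]].
apply/left_ideal_isoP; rewrite -?iotaM ?gg ?ff //.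
by exists (iota a), (iota b); rewrite -!iotaM ga af fb bg ab ba.
Qed.

(** A left ideal N of E is recovered as the intersection of E with the left ideal
    of all y such that e R y e is contained in N. *)
Lemma artinian_emb : artinian_module R^o -> artinian_module E^o.
Proof.
move=> art N decN.
pose P k : {pred R^o} := fun y : R => `[< forall r : R, (p (r * y) : E^o) \in N k >].
have Pc k : submod_closed (P k).
  split=> [|a x y /asboolP xN /asboolP yN]; apply/asboolP => r.
    by rewrite mulr0 -emb0 emb_projK; exact: (rpred0 (N k)).
  rewrite mulrDr emb_projD mulrA; exact: (@rpredD E^o (N k)).
pose L k : submodClosed R^o :=
  HB.pack (P k) (GRing.isSubmodClosed.Build R R^o (P k) (Pc k)).
have [k|k kP] := art L.
  by move=> y /asboolP yN; apply/asboolP => r; apply: decN.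
exists k => m km x xN; rewrite -[x]emb_projK -[iota x]mul1r.
have /asboolP : iota x \in L m; last by apply.
apply: kP km _ _; apply/asboolP => r; rewrite emb_projMr.
exact: (@rpredZ E E^o (N k)).
Qed.

End CornerEmbedding.
(** * Coinduced modules and injectivity of corners *)

Section Coinduction.
Variables (E R : pzRingType) (iota : E -> R) (A : lmodType E).

(** The left R-module of E-linear maps from e R to A. Maps are defined on all of R;
    [coindM] with c = 1 says that h x = h (e x), so they are determined by their
    restriction to e R. *)
Record coinduced := Coinduced {
  coind_fun :> R -> A;
  coindD : forall x y, coind_fun (x + y) = coind_fun x + coind_fun y;
  coindM : forall c x, coind_fun (iota c * x) = c *: coind_fun x
}.

Lemma coind_ext (h k : coinduced) : h =1 k -> h = k.
Proof.
case: h k => [h hD hM] [k kD kM] /= /funext hk; subst k.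
by congr Coinduced; exact: Prop_irrelevance.
Qed.

HB.instance Definition _ := gen_eqMixin coinduced.
HB.instance Definition _ := gen_choiceMixin coinduced.

Program Definition coind_zero := @Coinduced (fun=> 0) _ _.
Next Obligation. by rewrite addr0. Qed.
Next Obligation. by rewrite scaler0. Qed.

Program Definition coind_opp (h : coinduced) := @Coinduced (fun x => - h x) _ _.
Next Obligation. by rewrite coindD opprD. Qed.
Next Obligation. by rewrite coindM scalerN. Qed.

Program Definition coind_add (h k : coinduced) :=
  @Coinduced (fun x => h x + k x) _ _.
Next Obligation. by rewrite !coindD addrACA. Qed.
Next Obligation. by rewrite !coindM scalerDr. Qed.

Program Definition coind_scale (r : R) (h : coinduced) :=
  @Coinduced (fun x => h (x * r)) _ _.
Next Obligation. by rewrite mulrDl coindD. Qed.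
Next Obligation. by rewrite -mulrA coindM. Qed.

Lemma coind_addA : associative coind_add.
Proof. by move=> h k l; apply: coind_ext => x /=; rewrite addrA. Qed.
Lemma coind_addC : commutative coind_add.
Proof. by move=> h k; apply: coind_ext => x /=; rewrite addrC. Qed.
Lemma coind_add0 : left_id coind_zero coind_add.
Proof. by move=> h; apply: coind_ext => x /=; rewrite add0r. Qed.
Lemma coind_addN : left_inverse coind_zero coind_opp coind_add.
Proof. by move=> h; apply: coind_ext => x /=; rewrite addNr. Qed.

HB.instance Definition _ :=
  GRing.isZmodule.Build coinduced coind_addA coind_addC coind_add0 coind_addN.

Lemma coind_scaleA r s h : coind_scale r (coind_scale s h) = coind_scale (r * s) h.
Proof. by apply: coind_ext => x /=; rewrite mulrA. Qed.
Lemma coind_scale1 : left_id 1 coind_scale.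
Proof. by move=> h; apply: coind_ext => x /=; rewrite mulr1. Qed.
Lemma coind_scaleDr : right_distributive coind_scale +%R.
Proof. by move=> r h k; apply: coind_ext. Qed.
Lemma coind_scaleDl h : {morph coind_scale^~ h : r s / r + s}.
Proof. by move=> r s; apply: coind_ext => x /=; rewrite mulrDr coindD. Qed.

HB.instance Definition _ := GRing.Zmodule_isLmodule.Build R coinduced
  coind_scaleA coind_scale1 coind_scaleDr coind_scaleDl.

End Coinduction.

Section CoinducedMap.
Variables (E R : pzRingType) (iota : E -> R) (A B : lmodType E).
Variable f : {linear A -> B}.

Program Definition coind_map (h : coinduced iota A) : coinduced iota B :=
  @Coinduced _ _ _ _ (fun x => f (h x)) _ _.
Next Obligation. by rewrite coindD linearD. Qed.
Next Obligation. by rewrite coindM linearZ. Qed.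

Lemma coind_map_linear : linear coind_map.
Proof. by move=> r h k; apply: coind_ext => x /=; rewrite linearD. Qed.

HB.instance Definition _ :=
  GRing.isLinear.Build R (coinduced iota A) (coinduced iota B) _
    coind_map coind_map_linear.

Lemma coind_map_inj : injective f -> injective coind_map.
Proof.
move=> f_inj h k hk; apply: coind_ext => x; apply: f_inj.
by rewrite -[LHS]/(coind_map h x) hk.
Qed.

End CoinducedMap.

Arguments coind_map {E R} iota {A B} f h.

Section InjectiveCorner.
Variables (E R : pzRingType) (e : R) (iota : E -> R) (p : R -> E).
Hypothesis emb : corner_embedding e iota p.

(** The identification of A with e F(A), for F(A) the coinduced module. *)
Program Definition coind_elt (A : lmodType E) (a : A) : coinduced iota A :=
  @Coinduced _ _ _ _ (fun x => p x *: a) _ _.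
Next Obligation. by rewrite (emb_projD emb) scalerDl. Qed.
Next Obligation. by rewrite (emb_projMl emb) scalerA. Qed.

Lemma coind_eltP (A : lmodType E) c (a b : A) :
  coind_elt (c *: a + b) = iota c *: coind_elt a + coind_elt b.
Proof.
by apply: coind_ext => x /=; rewrite (emb_projMr emb) scalerDr scalerA.
Qed.

(** The unit of the adjunction between restriction to E and coinduction, on R
    followed by right multiplication by e; it only depends on y e. *)
Program Definition coind_reg (y : R^o) : coinduced iota E^o :=
  @Coinduced E R iota E^o (fun x : R => p (x * y)) _ _.
Next Obligation. by rewrite mulrDl (emb_projD emb). Qed.
Next Obligation. by rewrite -mulrA (emb_projMl emb). Qed.

Lemma coind_reg_linear : linear coind_reg.
Proof.
by move=> r x y; apply: coind_ext => z /=; rewrite mulrDr (emb_projD emb) mulrA.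
Qed.

HB.instance Definition _ :=
  GRing.isLinear.Build R R^o (coinduced iota E^o) _ coind_reg coind_reg_linear.

(** The hypothesis says that e kills no nonzero submodule of R e, so that R e
    embeds in its coinduced module by [coind_reg]; injectivity of R provides a
    retraction [rho]. Extending [rho] composed with the coinduced map of f, and
    restricting to the elements [coind_elt], gives the extension of f. *)
Lemma injective_emb :
  (forall x, x * e = x -> x != 0 -> exists r, e * r * x != 0) ->
  injective_module R^o -> injective_module E^o.
Proof.
move=> faithful_e injR.
pose i : {linear left_ideal e -> coinduced iota E^o} :=
  coind_reg \o (val : left_ideal e -> R^o).
have i_inj : injective i.
  apply: raddf_inj => y iy0.
  have ye : val y * e = val y.
    by rewrite -[LHS]/(val (rmul e (val y))) rmul_val // (emb_idem emb).
  apply: val_inj; apply/eqP/contraT => /(faithful_e _ ye)[r /negP[]].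
  have /(congr1 iota) : p (r * val y) = 0.
    by rewrite -[LHS]/(coind_fun (i y) r) iy0.
  by rewrite (emb_proj emb) (emb0 emb) -!mulrA ye => ->.
have [rho rhoE] := injR _ _ i (val : {linear left_ideal e -> R^o}) i_inj.
move=> A B j f j_inj.
have [g gE] := injR _ _ (coind_map iota j) (rho \o coind_map iota f)
  (coind_map_inj (iota := iota) j_inj).
pose g' (b : B) : E^o := p (g (coind_elt b)).
have g'_lin : linear g'.
  move=> c a b; rewrite /g' coind_eltP linearP (emb_projD emb).
  by congr (_ + _); exact: (emb_projMl emb).
pose G : {linear B -> E^o} := HB.pack g' (GRing.isLinear.Build E B E^o _ g' g'_lin).
exists G => a; rewrite /= /g'.
have -> : coind_elt (j a) = coind_map iota j (coind_elt a).
  by apply: coind_ext => x /=; rewrite linearZ.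
rewrite gE /=.
have -> : coind_map iota f (coind_elt a) = i (rmul e (iota (f a))).
  apply: coind_ext => x /=; rewrite linearZ /= (emb_mulr emb).
  by rewrite (emb_projMr emb).
by rewrite rhoE /= (emb_mulr emb) (emb_projK emb).
Qed.

End InjectiveCorner.

(** The annihilator of m = g x in R g is proper, hence contained in the radical,
    which kills the socle element t. So m |-> t defines a map on R m, and this
    map extends to A by injectivity. *)
Lemma cogenerator_of_injective (R : pzRingType) (I : finType) (eps : I -> R) :
  \sum_i eps i = 1 -> (forall i, local_idem (eps i)) ->
  (forall i, exists f, socle_link (eps i) f) ->
  injective_module R^o -> cogenerator R^o.
Proof.
move=> eps1 loc link injR A x x0.
have [i m0] : exists i, eps i *: x != 0.
  apply: contrapT => no; case/eqP: x0.
  rewrite -[x]scale1r -eps1 scaler_suml big1 // => i _.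
  by apply: contrapT => /eqP ix; apply: no; exists i.
have [gg _ locg] := loc i; have [f [t [gt tf t0] tmin]] := link i.
set g := eps i in m0 gg locg gt.
have gm : g *: (g *: x) = g *: x by rewrite scalerA gg.
set m := g *: x in m0 gm.
pose P : {pred A} := fun v => `[< exists c, v = c *: m >].
have Pc : submod_closed P.
  split=> [|a _ _ /asboolP[r ->] /asboolP[c ->]]; apply/asboolP.
    by exists 0; rewrite scale0r.
  by exists (a * r + c); rewrite scalerDl scalerA.
pose N : submodClosed A := HB.pack P (GRing.isSubmodClosed.Build R A P Pc).
have mN : m \in N by apply/asboolP; exists 1; rewrite scale1r.
pose mm : submodule N := Submodule mN.
have [y||h hm] := @linear_from_cyclic R (submodule N) R^o mm t.
- by have /asboolP[c yE] := valP y; exists c; apply: val_inj.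
- move=> r /(congr1 val) /= rm; apply/eqP/contraT => rt0.
  have [|q qt] := tmin (r * t) _ rt0; first by rewrite -mulrA tf.
  (* If r t were nonzero, q r t = t would make g - g q r g kill t and g q r g
     kill m, although one of the two is invertible in g R g. *)
  have [|v [[vu _]|[vu _]]] := locg (g * (q * r) * g).
  + by rewrite !mulrA gg -!mulrA gg.
  + by case/eqP: m0; rewrite -gm -vu -!scalerA gm rm !scaler0.
  case/eqP: t0; rewrite -gt -vu -mulrA mulrBl gt -!mulrA gt qt gt subrr.
  by rewrite mulr0.
have [F FE] := injR _ _ (val : {linear submodule N -> A}) h val_inj.
exists F; apply: contra_neq t0 => Fx.
by rewrite -hm -FE /= /m linearZ /= Fx scaler0.
Qed.

(** Some component x (eps j) is nonzero, so r x (eps j) = t for some r, and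
    e t = t because e fixes g. *)
Lemma faithful_links (R : pzRingType) (J : finType) (eps : J -> R) (e : R) :
  \sum_j eps j = e -> (forall j, eps j * eps j = eps j) ->
  (forall j, exists2 g, e * g = g & socle_link g (eps j)) ->
  forall x, x * e = x -> x != 0 -> exists r, e * r * x != 0.
Proof.
move=> epsE idem link x xe x0.
have [j xj0] : exists j, x * eps j != 0.
  apply: contrapT => no; case/eqP: x0; rewrite -xe -epsE mulr_sumr big1 // => j _.
  by apply: contrapT => /eqP xj; apply: no; exists j.
have [g eg [t [gt _ t0] tmin]] := link j.
have [|r rx] := tmin _ _ xj0; first by rewrite -mulrA idem.
exists r; apply: contra_neq t0 => erx.
by rewrite -gt -eg -mulrA gt -rx !mulrA erx mul0r.
Qed.

(** * Local rings and the canonical idempotents *)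

(** Elements outside the unique maximal left ideal N have a left inverse. A left
    inverse v of u is itself outside N, since otherwise 1 - u v would have a left
    inverse although (1 - u v) u = 0; hence v is also a right inverse. *)
Lemma local_idem1 (R : pzRingType) : local_ring R -> local_idem (1 : R).
Proof.
move=> [N [[z zN] maxN] uniqN].
have N1 : (1 : R) \notin N.
  by apply: contra zN => N1; rewrite -[z]mulr1; exact: (@rpredZ R R^o N).
have linv (u : R) : u \notin N -> exists v, v * u = 1.
  move=> uN; have [/asboolP[v vE]|no1] := boolP ((1 : R) \in principal u).
    by exists v.
  have [L /uniqN LN uL] := exists_maximal (N := principal u) no1.
  case/negP: uN; rewrite -LN; apply: uL; apply/asboolP.
  by exists 1; rewrite mul1r.
have notin1B (u : R) : u \in N -> 1 - u \notin N.
  by move=> uN; apply: contra N1 => u1; rewrite -(subrK u 1) (@rpredD R^o N).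
have inv (u : R) : u \notin N -> exists v, v * u = 1 /\ u * v = 1.
  move=> uN; have [v vu] := linv u uN; exists v; split=> //.
  have [vN|/linv[w wv]] := boolP (v \in N); last first.
    suff -> : u = w by [].
    by rewrite -[u]mul1r -wv -mulrA vu mulr1.
  have /notin1B/linv[w w1] : u * v \in N by exact: (@rpredZ R R^o N).
  case/negP: uN; suff -> : u = 0 by exact: (rpred0 N).
  by rewrite -[u]mul1r -w1 -mulrA mulrBl mul1r -mulrA vu mulr1 subrr mulr0.
split; first by rewrite mulr1.
  by apply: contraNneq N1 => ->; exact: (rpred0 N).
move=> u _; have [/notin1B/inv[v vE]|/inv[v vE]] := boolP (u \in N).
  by exists v; right.
by exists v; left.
Qed.

Section FormalMatrixIdempotents.
Variables (n : nat) (D : formal_matrix_data n).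
Implicit Types (i j k l : 'I_n) (A B : formal_matrix D).

Lemma fm_id0 i : fm_id (0 : fm_ring D i) = 0.
Proof. by apply: (addrI (fm_id 0)); rewrite -fm_idD !addr0. Qed.

Lemma ract0 (R S : pzRingType) (B : bimodule R S) (b : B) : ract b 0 = 0.
Proof. by apply: (addrI (ract b 0)); rewrite -ractDr !addr0. Qed.

Lemma ract0l (R S : pzRingType) (B : bimodule R S) (s : S) :
  ract (0 : B) s = 0.
Proof. by apply: (addrI (ract 0 s)); rewrite -ractDl !addr0. Qed.

Lemma entry0 i j : entry (0 : formal_matrix D) i j = 0.
Proof. exact: mk_matrixE. Qed.

Definition diag_unit i (r : fm_ring D i) : formal_matrix D :=
  fm_diag (dfwith (fun k => 0 : fm_ring D k) r).

Lemma diag_unitE i (r : fm_ring D i) : entry (diag_unit r) i i = fm_id r.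
Proof. by rewrite fm_diagE dfwith_in. Qed.

Lemma diag_unit0 i (r : fm_ring D i) k l :
  (k != i) || (l != i) -> entry (diag_unit r) k l = 0.
Proof.
have [<-|kl _] := eqVneq k l; last exact: fm_diag0.
by rewrite orbb => ki; rewrite fm_diagE dfwith_out ?fm_id0 // eq_sym.
Qed.

Lemma diag_unit_ext i (r : fm_ring D i) A :
  (forall k l, (k != i) || (l != i) -> entry A k l = 0) ->
  entry A i i = fm_id r -> diag_unit r = A.
Proof.
move=> A0 Ai; apply: matrix_ext => k l.
have [kl|] := boolP ((k != i) || (l != i)); first by rewrite diag_unit0 ?A0.
by rewrite negb_or !negbK => /andP[/eqP -> /eqP ->]; rewrite diag_unitE.
Qed.

Lemma entry_idem_mul i j A k l :
  entry (canonical_idem D i * A * canonical_idem D j) k l =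
  ract ((k == i)%:R *: entry A k l) (l == j)%:R.
Proof. by rewrite fm_mul_diagr fm_mul_diagl. Qed.

Lemma diag_unit_embedding i :
  exists p, corner_embedding (canonical_idem D i) (@diag_unit i) p.
Proof.
have [id_inv idK invK] := fm_id_bij D i.
exists (fun A => id_inv (entry A i i)); split.
- move=> r s rs; apply: (can_inj idK).
  by rewrite -!diag_unitE rs.
- move=> r s; apply: diag_unit_ext => [k l kl|]; rewrite entryD.
    by rewrite !diag_unit0 ?addr0.
  by rewrite !diag_unitE fm_idD.
- move=> r s; apply: diag_unit_ext => [k l kl|]; rewrite fm_mul_diagl.
    have [ki|ki] := eqVneq k i.
      by move: kl; rewrite ki eqxx /= => li; rewrite diag_unit0 ?li ?orbT ?scaler0.
    by rewrite dfwith_out ?scale0r // eq_sym.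
  by rewrite dfwith_in diag_unitE fm_idZ.
- apply: diag_unit_ext => [k l kl|]; last by rewrite fm_diagE eqxx.
  have [kl'|kl'] := eqVneq k l; last by rewrite fm_diag0.
  by move: kl; rewrite -kl' orbb => /negPf ki; rewrite fm_diagE ki fm_id0.
move=> A; apply: diag_unit_ext => [k l|]; rewrite entry_idem_mul; last first.
  by rewrite eqxx scale1r ract1 invK.
by case/orP => /negPf ->; rewrite ?scale0r ?ract0l ?ract0.
Qed.

Lemma local_canonical_idem i : local_idem (canonical_idem D i).
Proof.
have [p emb] := diag_unit_embedding i.
by rewrite -(emb1 emb); apply/(local_idem_emb emb)/local_idem1/fm_local.
Qed.

Variable I : {set 'I_n}.
Local Notation e := (idem_sum D I).
Local Notation eRe := (corner (idem_sumM D I)).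

Lemma corner_compress_subproof A : e * A * e \in corner_pred e.
Proof. by rewrite unfold_in !mulrA idem_sumM -!mulrA idem_sumM. Qed.

Definition corner_compress A : eRe :=
  Corner (idem_sumM D I) (corner_compress_subproof A).

Lemma corner_val_embedding :
  corner_embedding e (val : eRe -> formal_matrix D) corner_compress.
Proof. by split=> //; exact: val_inj. Qed.

Lemma idem_sum_sig : \sum_(i : {i | i \in I}) canonical_idem D (val i) = e.
Proof. by symmetry; exact: (@big_sub _ _ _ _ [in I] (canonical_idem D)). Qed.

Lemma corner_idem_sum : \sum_i @corner_idem n D I i = 1.
Proof. by apply: val_inj; rewrite raddf_sum; exact: idem_sum_sig. Qed.

Lemma local_corner_idem (i : {i | i \in I}) : local_idem (@corner_idem n D I i).
Proof.
by apply/(local_idem_emb corner_val_embedding)/local_canonical_idem.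
Qed.

End FormalMatrixIdempotents.

(** * Corners of rings with a Nakayama permutation *)

Theorem theorem17 (n : nat) (D : formal_matrix_data n) (pi : {perm 'I_n})
    (nakR : nakayama_permutation (@canonical_idem n D) pi)
    (essR : essential_socles (formal_matrix D))
    (I : {set 'I_n}) (I_neq0 : I != set0)
    (piI : forall i, i \in I -> pi i \in I) :
  [/\ nakayama_permutation (@corner_idem n D I) (perm_restr piI),
      essential_socles (corner (idem_sumM D I)),
      pseudo_frobenius (formal_matrix D) ->
        pseudo_frobenius (corner (idem_sumM D I))
    & quasi_frobenius (@canonical_idem n D) ->
        quasi_frobenius (@corner_idem n D I)].
Proof.
have [basicR nak] := nakR; have [essr essl] := essR.
set R := formal_matrix D; set E := corner (idem_sumM D I).
set sigma := perm_restr piI.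
pose eps i : R := canonical_idem D i.
pose epsE i : E := @corner_idem n D I i.
have emb := corner_val_embedding D I.
have emb_op := corner_embedding_op emb.
have idem i : eps i * eps i = eps i by rewrite canonical_idemM eqxx.
have idemE i : epsE i * epsE i = epsE i by apply: val_inj; exact: idem.
have loc i := local_canonical_idem D i.
have locE i : local_idem (epsE i) := local_corner_idem D i.
have locE_op i := local_idem_op (locE i).
have linkR i : socle_link (eps i) (eps (pi i)).
  exact: socle_link_of_iso (loc i) (idem _) essl (nak i).2.
(* In R^c the link runs from pi i to i, as soc(e_i R) is top(e_(pi i) R). *)
have linkR_op i : @socle_link R^c (eps (pi i)) (eps i).
  exact: (@socle_link_of_iso R^c) (local_idem_op (loc _)) (idem i) essr (nak i).1.
have sigmaE i : val (sigma i) = pi (val i) by rewrite permE.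
have linkE i : socle_link (epsE i) (epsE (sigma i)).
  by apply: (socle_link_emb emb); rewrite /= sigmaE; exact: linkR.
have linkE_op i : @socle_link E^c (epsE (sigma i)) (epsE i).
  by apply: (socle_link_emb emb_op); rewrite /= sigmaE; exact: linkR_op.
have nakE : nakayama_permutation (@corner_idem n D I) sigma.
  split=> [i j ij iso|i].
    apply: (basicR (val i) (val j)); first by rewrite (inj_eq val_inj).
    exact: (left_ideal_iso_emb emb_op (idemE i) (idemE j) iso).
  split; last exact: soc_top_iso (locE i) (idemE _) (linkE i).
  exact: (@soc_top_iso E^c) (locE_op _) (idemE i) (linkE_op i).
have sumE := corner_idem_sum D I.
have sumE_op : \sum_i (epsE i : E^c) = 1 := sumE.
split=> //.
- split.
    apply: (essential_socle sumE_op idemE) => i.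
    by exists (epsE (sigma i)).
  apply: (essential_socle sumE idemE) => i.
  by exists (epsE (sigma^-1 i)%g); rewrite -{2}(permKV sigma i).
- move=> [[injr _] [injl _]].
  have injEr : injective_module (E^c)^o.
    apply: (injective_emb emb_op _ injr).
    apply: (@faithful_links R^c _ (fun j : {i | i \in I} => eps (val j))).
      exact: idem_sum_sig.
      by move=> j; exact: idem.
    move=> j; exists (eps (val (sigma j))); first by apply: idem_sumr; exact: valP.
    by rewrite sigmaE; exact: linkR_op.
  have injEl : injective_module E^o.
    apply: (injective_emb emb _ injl).
    apply: (@faithful_links R _ (fun j : {i | i \in I} => eps (val j))).
      exact: idem_sum_sig.
      by move=> j; exact: idem.
    (* Left links end at pi i: j in I has to be pi i with i again in I, which is
       where the finiteness of I is used. *)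
    move=> j; exists (eps (val (sigma^-1 j)%g)); first by apply: idem_suml; exact: valP.
    by rewrite -{2}(permKV sigma j) sigmaE; exact: linkR.
  split; split=> //.
    apply: (cogenerator_of_injective sumE_op locE_op) injEr => i.
    by exists (epsE (sigma^-1 i)%g); rewrite -{1}(permKV sigma i).
  by apply: (cogenerator_of_injective sumE locE) injEl => i; exists (epsE (sigma i)).
move=> [[artr artl] _]; split; last by exists sigma.
by split; [exact: (artinian_emb emb_op)|exact: (artinian_emb emb)].
Qed.
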